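(* Let $-\infty<t_1<t_2<+\infty$, $z\in\mathbb C^{\rm up}$, $a\in(0,1)$. (1) If $a|z|\ge\max\{|t_1|,|t_2|\}$, then $$\omega(z,[t_1,t_2])\le\frac{t_2-t_1}{\pi(1-a)^2}\operatorname{Im}\frac1{\bar z}.$$ (2) If $a\cdot\min_{t\in[t_1,t_2]}|t|\ge|z|$, then $$\omega(z,[t_1,t_2])\le\frac{(t_2-t_1)\,a^2}{\pi(1-a)^2}\operatorname{Im}\frac1{\bar z}.$$
   Context: $\mathbb C^{\rm up}=\{\operatorname{Im}z>0\}$. Harmonic measure of the upper half-plane: $\omega(z,B)=\frac1\pi\int_{B\cap\mathbb R}\frac{\operatorname{Im}z}{(t-\operatorname{Re}z)^2+(\operatorname{Im}z)^2}\,dt$ for $z\in\mathbb C^{\rm up}$ and Borel $B$. *)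

(* Defs.v *)
From HB Require Import structures.
From mathcomp Require Import all_boot all_order all_algebra.
From mathcomp Require Import all_classical all_reals all_analysis.
From mathcomp Require Import complex.

Set Implicit Arguments.
Unset Strict Implicit.
Unset Printing Implicit Defensive.

Import Order.TTheory GRing.Theory Num.Theory.

Local Open Scope classical_set_scope.
Local Open Scope ring_scope.
Local Open Scope complex_scope.

(* [B] is a set of complex numbers; only its trace on the real line matters.
   The value is meaningful for [0 < complex.Im z] and [B] Borel. *)
Definition harmonic_measure (R : realType) (z : R[i]) (B : set R[i]) : \bar R :=
  ((pi^-1)%:E *
   \int[lebesgue_measure]_(t in [set t : R | B t%:C])
     (complex.Im z / ((t - complex.Re z) ^+ 2 + complex.Im z ^+ 2))%:E)%E.

(* The real interval [[s, t]], viewed as a subset of the complex plane. *)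
Definition real_segment (R : realType) (s t : R) : set R[i] :=
  [set x%:C | x in `[s, t]].

(* Main.v *)
(* The reverse triangle inequality |t - z| >= | |t| - |z| | bounds the Poisson
   kernel on [t1, t2] by Im z / ((1 - a) |z|)^2 in case (1) and by
   Im z / ((1 - a) |z| / a)^2 in case (2); integrating the constant bound
   suffices, since Im (1 / z^* ) = Im z / |z|^2. *)
Require Import Defs.
From HB Require Import structures.
From mathcomp Require Import all_boot all_order all_algebra.
From mathcomp Require Import all_classical all_reals all_analysis.
From mathcomp Require Import complex measurable_realfun ring lra.

Set Implicit Arguments.
Unset Strict Implicit.
Unset Printing Implicit Defensive.

Import Order.TTheory GRing.Theory Num.Theory.
Import numFieldNormedType.Exports.

Local Open Scope classical_set_scope.
Local Open Scope ring_scope.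
Local Open Scope complex_scope.

(** Supplies the measurability of the integrand; [0 < y] keeps the denominator away from zero. *)
Lemma continuous_poisson_kernel (R : realType) (x y : R) : 0 < y ->
  continuous (fun t : R => y / ((t - x) ^+ 2 + y ^+ 2)).
Proof.
move=> y0 t; apply: cvgM; first exact: cvg_cst.
apply: cvgV; first by rewrite gt_eqF// ltr_wpDl ?sqr_ge0// exprn_gt0.
by apply: cvgD; [apply: cvgM; apply: cvgB; (exact: cvg_id || exact: cvg_cst)
                |exact: cvg_cst].
Qed.

Lemma real_segment_trace (R : realType) (s t : R) :
  [set x : R | real_segment s t x%:C] = [set` `[s, t]].
Proof.
apply/seteqP; split => [x [u su [<-]]//|x sx].
by exists x.
Qed.

(** The kernel is at most [Im z / m] on the segment, and a constant integrates to itself times the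
    length [t - s]. Both cases of the theorem are instances, differing only in [m]. *)
Lemma harmonic_measure_le (R : realType) (s t m : R) (z : R[i]) :
  s <= t -> 0 < complex.Im z -> 0 < m ->
  (forall u, u \in `[s, t] ->
    m <= (u - complex.Re z) ^+ 2 + complex.Im z ^+ 2) ->
  (harmonic_measure z (real_segment s t) <=
    ((t - s) / (pi * m) * complex.Im z)%:E)%E.
Proof.
move=> st z0 m0 Hm; rewrite /harmonic_measure real_segment_trace.
have -> : (t - s) / (pi * m) * complex.Im z
    = pi^-1 * (complex.Im z / m * (t - s)).
  by rewrite invfM; lra.
rewrite EFinM lee_wpmul2l//; first by rewrite lee_fin invr_ge0 pi_ge0.
have mu_st : lebesgue_measure (`[s, t]%classic : set R) = (t - s)%:E.
  rewrite lebesgue_measure_itv/= lte_fin.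
  (* The measure formula branches on [s < t]; for [s = t] its value 0 agrees with [t - s]. *)
  by move: st; rewrite le_eqVlt => /orP[/eqP ->|->]; rewrite ?ltxx ?subrr ?EFinB.
rewrite EFinM -mu_st -integral_cst//.
apply: ge0_le_integral => //.
- by move=> u _; rewrite lee_fin divr_ge0 ?addr_ge0 ?sqr_ge0// ltW.
- apply/measurable_EFinP; apply: measurable_funTS.
  by apply: continuous_measurable_fun; exact: continuous_poisson_kernel.
- move=> u /Hm mu; rewrite lee_fin ler_pM2l// lef_pV2//.
  by rewrite posrE (lt_le_trans m0).
Qed.

Lemma sqr_normc (R : realType) (z : R[i]) :
  ComplexField.Normc.normc z ^+ 2 = complex.Re z ^+ 2 + complex.Im z ^+ 2.
Proof. by case: z => x y /=; rewrite sqr_sqrtr// addr_ge0 ?sqr_ge0. Qed.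

Lemma Im_inv_conjc (R : realType) (z : R[i]) :
  complex.Im (1 / z^*) = complex.Im z / ComplexField.Normc.normc z ^+ 2.
Proof.
by rewrite div1r sqr_normc; case: z => x y /=; rewrite sqrrN mulNr opprK.
Qed.

Lemma normc_gt0_Im (R : realType) (z : R[i]) :
  0 < complex.Im z -> 0 < ComplexField.Normc.normc z.
Proof.
by case: z => x y /= y0; rewrite sqrtr_gt0 ltr_wpDl ?sqr_ge0// exprn_gt0.
Qed.

(** After expansion the square terms cancel, by [|t|^2 = t^2] and [|z|^2 = x^2 + y^2]; what remains
    is [t * Re z <= |t| |z|]. *)
Lemma sqr_dist_ge (R : realType) (t : R) (z : R[i]) :
  (`|t| - ComplexField.Normc.normc z) ^+ 2
    <= (t - complex.Re z) ^+ 2 + complex.Im z ^+ 2.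
Proof.
have xN : `|complex.Re z| <= ComplexField.Normc.normc z.
  by case: z => x y /=; rewrite -sqrtr_sqr ler_wsqrtr// lerDl sqr_ge0.
have tx : t * complex.Re z <= `|t| * ComplexField.Normc.normc z.
  by rewrite (le_trans (ler_norm _))// normrM ler_wpM2l.
move: (sqr_normc z) (real_normK (num_real t)) tx; rewrite !expr2.
move: (ComplexField.Normc.normc z : R) `|t| (complex.Re z) (complex.Im z).
by clear; move=> N T x y; lra.
Qed.

(* The minimum of |t| over the nonempty compact [t1, t2] is attained, so [inf]
   is the minimum. [normc z : R] is the real-valued modulus of [z]. *)
Theorem mainTheorem10 (R : realType) (t1 t2 : R) (z : R[i]) (a : R)
    (ht : t1 < t2) (hz : 0 < complex.Im z) (ha : 0 < a < 1) :
  (Num.max `|t1| `|t2| <= a * ComplexField.Normc.normc z ->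
   (harmonic_measure z (real_segment t1 t2) <=
     ((t2 - t1) / (pi * (1 - a) ^+ 2) * complex.Im (1 / z^*))%:E)%E)
  /\
  (ComplexField.Normc.normc z <= a * inf [set `|t| | t in `[t1, t2]] ->
   (harmonic_measure z (real_segment t1 t2) <=
     ((t2 - t1) * a ^+ 2 / (pi * (1 - a) ^+ 2) * complex.Im (1 / z^*))%:E)%E).
Proof.
have /andP[a0 a1] := ha; have N0 := normc_gt0_Im hz.
rewrite Im_inv_conjc; set N : R := ComplexField.Normc.normc z in N0 *.
have N0' : N != 0 by rewrite gt_eqF.
have a1' : 1 - a != 0 by rewrite subr_eq0 gt_eqF.
have pi0 : pi != 0 :> R by rewrite gt_eqF ?pi_gt0.
split=> [htN|hNt].
- have -> : (t2 - t1) / (pi * (1 - a) ^+ 2) * (complex.Im z / N ^+ 2)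
      = (t2 - t1) / (pi * ((1 - a) * N) ^+ 2) * complex.Im z.
    by move: (pi : R) pi0 => p p0; field; rewrite N0' a1' p0.
  apply: harmonic_measure_le => //; first exact: ltW.
    by rewrite exprn_gt0// mulr_gt0// subr_gt0.
  move=> t; rewrite in_itv/= => /andP[t1t tt2].
  (* Here [|t| <= a * N < N], so the sign is flipped to compare squares of nonnegative numbers. *)
  apply: le_trans (sqr_dist_ge t z); rewrite -/N -(sqrrN (`|t| - N)).
  have tN : `|t| <= a * N.
    move: htN; rewrite ge_max !ler_norml => /andP[/andP[? ?] /andP[? ?]].
    by apply/andP; split; lra.
  by rewrite ler_sqr ?nnegrE; nra.
- have a0' : a != 0 by rewrite gt_eqF.
  have -> : (t2 - t1) * a ^+ 2 / (pi * (1 - a) ^+ 2) * (complex.Im z / N ^+ 2)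
      = (t2 - t1) / (pi * ((1 - a) * N / a) ^+ 2) * complex.Im z.
    by move: (pi : R) pi0 => p p0; field; rewrite N0' a1' a0' p0.
  apply: harmonic_measure_le => //; first exact: ltW.
    by rewrite exprn_gt0// divr_gt0// mulr_gt0// subr_gt0.
  move=> t t12.
  apply: le_trans (sqr_dist_ge t z); rewrite -/N.
  have Nt : N <= a * `|t|.
    (* The infimum lies below each [|t|] because the set is bounded below, by 0. *)
    rewrite (le_trans hNt)// ler_wpM2l ?(ltW a0)// ge_inf//; last by exists t.
    by exists 0 => _ [u _ <-].
  (* From [N / a <= |t|], subtracting [N] gives [(1 - a) * N / a = N / a - N <= |t| - N]. *)
  have le : (1 - a) * N / a <= `|t| - N by rewrite ler_pdivrMr//; nra.
  have ge0 : 0 <= (1 - a) * N / a.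
    by rewrite divr_ge0 ?mulr_ge0 ?subr_ge0 ?(ltW a0) ?(ltW a1) ?(ltW N0).
  by rewrite ler_sqr// nnegrE (le_trans ge0).
Qed.
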